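(* Let $V$ be a finite set and let $(X^{(n)}_t)_{t\ge 0}$, $n\ge 1$, be irreducible continuous-time Markov chains on $V$ with jump rates $R_n(x,y)$ such that the set $E=\{(x,y)\in V\times V:x\neq y,\ R_n(x,y)>0\}$ does not depend on $n$. Assume that for every $(x,y)\in E$ the limit $\mathbb R_0(x,y)=\lim_{n\to\infty}R_n(x,y)\in[0,\infty)$ exists, and that $\mathbb E_0=\{(x,y)\in E:\mathbb R_0(x,y)>0\}$ is non-empty. Define $I_n,\mathbf I^{(0)}:\mathscr P(V)\times\mathfrak F_E\to[0,+\infty]$ by $$I_n(\mu,J)=\sum_{(x,y)\in E}\Phi\big(J(x,y),\mu(x)R_n(x,y)\big)\ \text{ if } J\in\mathfrak F_E^{\rm div},\qquad I_n(\mu,J)=+\infty\ \text{ otherwise},$$ $$\mathbf I^{(0)}(\mu,J)=\sum_{(x,y)\in\mathbb E_0}\Phi\big(J(x,y),\mu(x)\mathbb R_0(x,y)\big)\ \text{ if } J\in\mathfrak F_{\mathbb E_0}^{\rm div},\qquad \mathbf I^{(0)}(\mu,J)=+\infty\ \text{ otherwise}.$$ Then $I_n$ $\Gamma$-converges to $\mathbf I^{(0)}$ as $n\to\infty$.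
   Context: $\mathscr P(V)$ is the set of probability measures on $V$. A flow is a function $J:E\to\mathbb R_+=[0,\infty)$; $\mathfrak F_E$ is the set of flows (with the topology of $\mathbb R_+^E$). $J$ is divergence-free if $\sum_{y:(x,y)\in E}J(x,y)=\sum_{y:(y,x)\in E}J(y,x)$ for all $x\in V$; $\mathfrak F_E^{\rm div}$ is the set of divergence-free flows. For $E'\subset E$, $\mathfrak F_{E'}$ is the set of $J\in\mathfrak F_E$ vanishing on $E\setminus E'$, and $\mathfrak F^{\rm div}_{E'}$ its divergence-free elements. $\Phi:\mathbb R_+\times\mathbb R_+\to[0,+\infty]$ is given by $\Phi(q,p)=p$ if $q=0$; $\Phi(q,p)=q\log(q/p)-(q-p)$ if $q,p\in(0,\infty)$; $\Phi(q,p)=+\infty$ if $q>0$, $p=0$. $\Gamma$-convergence: on a Polish space $\mathcal X$, functionals $U_n:\mathcal X\to[0,+\infty]$ $\Gamma$-converge to $U:\mathcal X\to[0,+\infty]$ if for each $x$: $\liminf_n U_n(x_n)\ge U(x)$ for every sequence $x_n\to x$, and there is a sequence $x_n\to x$ with $\limsup_nU_n(x_n)\le U(x)$. *)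

(* Defs.v *)
From HB Require Import structures.
From mathcomp Require Import all_boot all_order all_algebra.
From mathcomp Require Import all_classical all_reals all_analysis.

Set Implicit Arguments.
Unset Strict Implicit.
Unset Printing Implicit Defensive.

Import Order.TTheory GRing.Theory Num.Theory.
Import numFieldNormedType.Exports.

Local Open Scope classical_set_scope.
Local Open Scope ring_scope.

(* Gamma-convergence, in its sequential form: on metrizable (in particular
   Polish) spaces this is the usual notion. *)
Definition gamma_cvg (R : realType) (X : topologicalType)
    (U_ : nat -> X -> \bar R) (U : X -> \bar R) : Prop :=
  forall x : X,
    (forall x_ : nat -> X, x_ @ \oo --> x ->
       (U x <= limn_einf (fun n => U_ n (x_ n)))%E) /\
    (exists2 x_ : nat -> X, x_ @ \oo --> x &
       (limn_esup (fun n => U_ n (x_ n)) <= U x)%E).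

(* The finite set V with the sigma-algebra of all its subsets. Measurable types
   are pointed in the library, hence the base point x0; it plays no other role. *)
Definition discrete_meas (V : finType) (x0 : V) : Type := V.

HB.instance Definition _ (V : finType) (x0 : V) :=
  Finite.on (@discrete_meas V x0).
HB.instance Definition _ (V : finType) (x0 : V) :=
  isPointed.Build (@discrete_meas V x0) x0.
HB.instance Definition _ (V : finType) (x0 : V) :=
  @isMeasurable.Build default_measure_display (@discrete_meas V x0)
    discrete_measurable discrete_measurable0
    discrete_measurableC discrete_measurableU.

Section spaces.
Context (R : realType) (V : finType) (x0 : V).
Implicit Types (E : {set V * V}) (r : V -> V -> R).

Definition mass (mu : probability (discrete_meas x0) R) (x : V) : R :=
  fine (mu [set x]).

(* The probability measures on V, topologized as a subset of R^V. *)
Definition prob : Type :=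
  initial_topology (mass : _ -> {ptws V -> R}).

Definition edge E : finType := {e : V * V | e \in E}.

Definition src E (e : edge E) : V := (val e).1.
Definition tgt E (e : edge E) : V := (val e).2.

(* Flows: nonnegative functions on E, with the subspace topology of R^E. *)
Definition flow E : Type :=
  [set J : {ptws edge E -> R} | forall e, 0 <= J e].

Definition flow_fun E (J : flow E) : edge E -> R := \val J.
Coercion flow_fun : flow >-> Funclass.

Definition divergence_free E (J : flow E) : Prop :=
  forall x : V,
    \sum_(e : edge E | src e == x) J e = \sum_(e : edge E | tgt e == x) J e.

Definition vanishes_off E (E' : {set V * V}) (J : flow E) : Prop :=
  forall e : edge E, val e \notin E' -> J e = 0.

(* Only meant for q, p >= 0. *)
Definition Phi (q p : R) : \bar R :=
  if q == 0 then p%:E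
  else if p == 0 then +oo%E
  else (q * ln (q / p) - (q - p))%:E.

Definition jump r : rel V := fun x y => (x != y) && (0 < r x y).

Definition jump_edges r : {set V * V} := [set e | jump r e.1 e.2]%SET.

(* Jump rates of an irreducible continuous-time Markov chain; the diagonal
   values of r are irrelevant. *)
Definition jump_rates r : Prop := forall x y, x != y -> 0 <= r x y.

Definition irreducible r : Prop := forall x y, connect (jump r) x y.

Definition rate_functional E r (z : prob * flow E) : \bar R :=
  if `[< divergence_free z.2 >] then
    (\sum_(e : edge E) Phi (z.2 e) (mass z.1 (src e) * r (src e) (tgt e)))%E
  else +oo%E.

Definition limit_edges E r0 : {set V * V} :=
  [set e in E | 0 < r0 e.1 e.2]%SET.

Definition limit_functional E r0 (z : prob * flow E) : \bar R :=
  let E0 := limit_edges E r0 in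
  if `[< vanishes_off E0 z.2 /\ divergence_free z.2 >] then
    (\sum_(e : edge E | val e \in E0)
       Phi (z.2 e) (mass z.1 (src e) * r0 (src e) (tgt e)))%E
  else +oo%E.

End spaces.

(* Main.v *)
(** Since [Phi q 0] is [+oo] for [q > 0], letting the sum run over all of [E]
    penalizes any flow through an edge with zero limit rate: the limit
    functional is the rate functional of the limit rates. By Legendre duality
    [Phi] is a supremum of affine functions, hence lower semicontinuous, and
    divergence-free flows form a closed set: this gives the liminf inequality.
    As [Phi q] is continuous for fixed [q], constant sequences are recovery
    sequences. *)
Require Import Defs.
From mathcomp Require Import all_boot all_order all_algebra.
From mathcomp Require Import all_classical all_reals all_analysis.
From mathcomp Require Import ring lra.

Set Implicit Arguments.
Unset Strict Implicit.
Unset Printing Implicit Defensive.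

Import Order.TTheory GRing.Theory Num.Theory.
Import numFieldNormedType.Exports.

Local Open Scope classical_set_scope.
Local Open Scope ring_scope.

(** * Lower limits of extended real sequences *)

Lemma le_limn_einf (R : realType) (u v : nat -> \bar R) :
  (\forall n \near \oo, (u n <= v n)%E) -> (limn_einf u <= limn_einf v)%E.
Proof.
move=> uv; rewrite !limn_einf_lim.
apply: lee_lim; [exact: is_cvg_einfs|exact: is_cvg_einfs|].
case: uv => N _ uv; exists N => // n /= Nn.
apply: le_ereal_inf_tmp => _ [k /= nk <-].
apply: le_trans (uv k (leq_trans Nn nk)).
by apply: ereal_inf_lbound; exists k.
Qed.

(** The infimum of a tail of sums dominates the sum of the tail infima. Nonnegativity rules out
    [+oo - oo], so the finite sum of tail infima converges to the sum of their limits. *)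
Lemma limn_einf_nnesum (R : realType) (I : finType) (u : I -> nat -> \bar R) :
  (forall i n, (0 <= u i n)%E) ->
  (\sum_i limn_einf (u i) <= limn_einf (fun n => \sum_i u i n))%E.
Proof.
move=> u0.
have cvg_sum : (\sum_i einfs (u i) n)%E @[n --> \oo] -->
    (\sum_i limn_einf (u i))%E.
  apply: cvg_nnesum => i _.
    by apply: nearW => n; apply: le_ereal_inf_tmp => _ [k _ <-].
  by rewrite limn_einf_lim; exact: is_cvg_einfs.
rewrite [leRHS]limn_einf_lim -(cvg_lim _ cvg_sum)//.
apply: lee_lim; [exact: cvgP cvg_sum|exact: is_cvg_einfs|].
apply: nearW => n; apply: le_ereal_inf_tmp => _ [k /= nk <-].
by apply: lee_sum => i _; apply: ereal_inf_lbound; exists k.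
Qed.

Lemma EFin_cvg (R : realType) (u : nat -> R) l :
  u @ \oo --> l -> (u n)%:E @[n --> \oo] --> l%:E.
Proof. by move=> ul; apply: cvg_EFin => //; exact: nearW. Qed.

Lemma limn_ge0 (R : realType) (u : nat -> R) l :
  (forall n, 0 <= u n) -> u @ \oo --> l -> 0 <= l.
Proof.
move=> u0 ul; rewrite -(cvg_lim _ ul)//.
by apply: limr_ge; [exact: cvgP ul|exact: nearW].
Qed.

(** * Legendre duality and limits of [Phi] *)

Section Phi_duality.
Context {R : realType}.
Implicit Types q p l : R.

Lemma Phi0l p : Phi 0 p = p%:E.
Proof. by rewrite /Phi eqxx. Qed.

Lemma Phi0r q : 0 < q -> Phi q 0 = +oo%E.
Proof. by move=> q0; rewrite /Phi gt_eqF// eqxx. Qed.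

Lemma Phi_pos q p : 0 < q -> 0 < p ->
  Phi q p = (q * ln (q / p) - (q - p))%:E.
Proof. by move=> q0 p0; rewrite /Phi !gt_eqF. Qed.

(* Legendre duality: [Phi q p] is the supremum over [l] of the functions
   [l * q - p * (expR l - 1)], which are affine in [(q, p)]. *)
Lemma Phi_ge_dual q p l : 0 <= q -> 0 <= p ->
  ((l * q - p * (expR l - 1))%:E <= Phi q p)%E.
Proof.
rewrite le_eqVlt => /predU1P[<-|q0].
  by move=> p0; rewrite Phi0l lee_fin; have := mulr_ge0 p0 (expR_ge0 l); lra.
rewrite le_eqVlt => /predU1P[<-|p0]; first by rewrite Phi0r ?leey.
rewrite Phi_pos// lee_fin.
(* This is [1 + x <= expR x] at [x = l - ln (q / p)], scaled by [q]. *)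
have : q * (1 + (l - ln (q / p))) <= p * expR l.
  have -> : p * expR l = q * expR (l - ln (q / p)).
    rewrite expRD expRN lnK ?posrE ?divr_gt0//.
    by field; rewrite !gt_eqF.
  by rewrite ler_pM2l// expR_ge1Dx.
lra.
Qed.

Lemma Phi_ge0 q p : 0 <= q -> 0 <= p -> (0 <= Phi q p)%E.
Proof.
move=> q0 p0; have := @Phi_ge_dual _ _ 0 q0 p0.
by rewrite mul0r expR0 subrr mulr0 subrr.
Qed.

(** The other half of the duality. The supremum is approached as [l] tends to [-oo] when [q = 0], is
    reached at [l = ln (q / p)] when both arguments are positive, and diverges as [l] tends to [+oo]
    when only [p] vanishes. *)
Lemma Phi_le_dual q p (c : \bar R) : 0 <= q -> 0 <= p ->
  (forall l, ((l * q - p * (expR l - 1))%:E <= c)%E) -> (Phi q p <= c)%E.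
Proof.
rewrite le_eqVlt => /predU1P[<-|q0].
  move=> p0 dual_le; rewrite Phi0l; apply/lee_addgt0Pr => e e0.
  have p1 : 0 < p + 1 by lra.
  (* This [l] makes the loss [p * expR l] smaller than [e]; dividing by [p + 1] keeps the choice
     valid at [p = 0]. *)
  have := dual_le (ln (e / (p + 1))).
  rewrite lnK ?posrE ?divr_gt0// -(leeD2rE _ _ (_ : e%:E \is a fin_num))//.
  apply: le_trans; rewrite -EFinD lee_fin.
  have : e / (p + 1) * (p + 1) = e by field; rewrite gt_eqF.
  have : 0 < e / (p + 1) by rewrite divr_gt0.
  lra.
rewrite le_eqVlt => /predU1P[<-|p0].
  move=> dual_le; rewrite Phi0r// leye_eq; apply/eqP/eqyP => A A0.
  have := dual_le (A / q).
  by rewrite mul0r subr0 divfK ?gt_eqF.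
move=> /(_ (ln (q / p))); rewrite lnK ?posrE ?divr_gt0//; apply: le_trans.
rewrite Phi_pos// lee_fin (_ : p * (q / p - 1) = q - p); first lra.
by field; rewrite gt_eqF.
Qed.

Lemma cvg_dual l q p (q_ p_ : nat -> R) :
  q_ @ \oo --> q -> p_ @ \oo --> p ->
  l * q_ n - p_ n * (expR l - 1) @[n --> \oo] --> l * q - p * (expR l - 1).
Proof.
by move=> cq cp; apply: cvgB; [exact: cvgMr|exact: cvgMl].
Qed.

Lemma Phi_lsc q p (q_ p_ : nat -> R) :
  (forall n, 0 <= q_ n) -> (forall n, 0 <= p_ n) ->
  q_ @ \oo --> q -> p_ @ \oo --> p ->
  (Phi q p <= limn_einf (fun n => Phi (q_ n) (p_ n)))%E.
Proof.
move=> q_0 p_0 cq cp; apply: Phi_le_dual => [||l].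
- by apply: limn_ge0 cq.
- by apply: limn_ge0 cp.
(* For fixed [l] the dual function converges along the sequence, so its limit is a lower limit and
   can be compared termwise with [Phi]. *)
have [<- _] := cvg_limn_einf_sup (EFin_cvg (@cvg_dual l q p q_ p_ cq cp)).
by apply: le_limn_einf; apply: nearW => n; exact: Phi_ge_dual.
Qed.

Lemma Phi_cvgr q p (p_ : nat -> R) : 0 <= q ->
  (forall n, 0 <= p_ n) -> p_ @ \oo --> p ->
  Phi q (p_ n) @[n --> \oo] --> Phi q p.
Proof.
rewrite le_eqVlt => /predU1P[<-|q0] p_0 cp.
  by under eq_fun do rewrite Phi0l; rewrite Phi0l; exact: EFin_cvg.
have : 0 <= p by apply: limn_ge0 cp.
rewrite le_eqVlt => /predU1P[p0|p0].
  subst p; rewrite Phi0r//; apply/cvgeyPge => A.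
  (* With this slope the dual lower bound tends to [A + 1], hence eventually exceeds [A]. It holds
     also at indices where [p_ n = 0]. *)
  have := @cvg_dual ((A + 1) / q) _ _ _ _ (cvg_cst q) cp.
  rewrite mul0r subr0 divfK ?gt_eqF// => cA.
  have A1 : A < A + 1 by rewrite ltrDl.
  apply: filterS (cvgr_gt _ (cA _) A A1) => n An.
  apply: le_trans (@Phi_ge_dual _ _ ((A + 1) / q) (ltW q0) (p_0 n)).
  by rewrite lee_fin divfK ?gt_eqF//; exact: ltW.
rewrite Phi_pos//.
apply: (@cvg_trans _ ((q * ln (q / p_ n) - (q - p_ n))%:E @[n --> \oo])).
  apply: near_eq_cvg; apply: filterS (cvgr_gt _ cp 0 p0) => n pn.
  by rewrite Phi_pos.
have qp : 0 < q / p by rewrite divr_gt0.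
have cqp : q / p_ n @[n --> \oo] --> q / p.
  by apply: cvgMr; apply: cvgV => //; rewrite gt_eqF.
apply: EFin_cvg; apply: cvgB; last by apply: cvgB => //; exact: cvg_cst.
by apply: cvgMr; exact: (continuous_cvg _ (@continuous_ln _ _ qp) cqp).
Qed.

End Phi_duality.

(** * Continuity of the coordinates, and the limit functional as a rate functional *)

Section functionals.
Context {R : realType} {V : finType} {x0 : V} {E : {set V * V}}.
Implicit Types (z : prob R x0 * flow R E) (r : V -> V -> R).

Lemma mass_ge0 (mu : prob R x0) x : 0 <= mass mu x.
Proof. exact: fine_ge0. Qed.

Lemma flow_ge0 (J : flow R E) e : 0 <= J e.
Proof. exact: (set_valP J). Qed.

Lemma mass_continuous x : continuous (fun z => mass z.1 x).
Proof.
move=> z; apply: (@continuous_comp _ _ _ fst (fun mu : prob R x0 => mass mu x)).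
  exact: cvg_fst.
apply: (@continuous_comp (prob R x0) {ptws V -> R} R (@mass R V x0) (fun f => f x)).
  exact: initial_continuous.
exact: (@proj_continuous V (fun=> R) x).
Qed.

Lemma flow_continuous e : continuous (fun z => z.2 e).
Proof.
move=> z; apply: (@continuous_comp _ _ _ snd (fun J : flow R E => J e)).
  exact: cvg_snd.
apply: (@continuous_comp (flow R E) {ptws edge E -> R} R (@flow_fun R V E)
  (fun f => f e)).
  exact: initial_continuous.
exact: (@proj_continuous (edge E) (fun=> R) e).
Qed.

Lemma cvg_mass (z_ : nat -> prob R x0 * flow R E) z x :
  z_ @ \oo --> z -> mass (z_ n).1 x @[n --> \oo] --> mass z.1 x.
Proof. by move=> cz; apply: (continuous_cvg _ (@mass_continuous x z) cz). Qed.

Lemma cvg_flow (z_ : nat -> prob R x0 * flow R E) z e :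
  z_ @ \oo --> z -> (z_ n).2 e @[n --> \oo] --> z.2 e.
Proof. by move=> cz; apply: (continuous_cvg _ (@flow_continuous e z) cz). Qed.

(** The net outflow at a vertex is a finite combination of continuous coordinates, so a nonzero
    value at the limit persists along the sequence. *)
Lemma divergence_free_closed (z_ : nat -> prob R x0 * flow R E) z :
  z_ @ \oo --> z -> ~ divergence_free z.2 ->
  \forall n \near \oo, ~ divergence_free (z_ n).2.
Proof.
move=> cz; rewrite /divergence_free -existsNE => -[x /eqP].
rewrite -subr_eq0 => divx.
have cvg_div : \sum_(e | src e == x) (z_ n).2 e -
    \sum_(e | tgt e == x) (z_ n).2 e @[n --> \oo] -->
    \sum_(e | src e == x) z.2 e - \sum_(e | tgt e == x) z.2 e.
  by apply: cvgB; (apply: cvg_big => [|e _];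
    [exact: add_continuous|exact: cvg_flow]).
apply: filterS (cvgr_neq0 _ cvg_div divx) => n /eqP divx_n /(_ x) dx.
by apply: divx_n; rewrite dx subrr.
Qed.

Lemma limit_functionalE r z : (forall e : edge E, 0 <= r (src e) (tgt e)) ->
  limit_functional r z = rate_functional r z.
Proof.
move=> r_ge0; rewrite /limit_functional /rate_functional.
have E0N (e : edge E) : val e \notin limit_edges E r -> r (src e) (tgt e) = 0.
  rewrite inE (valP e)/= -leNgt => r_le0.
  by apply/eqP; rewrite eq_le r_ge0 r_le0.
have [div_free|Ndiv] := pselect (divergence_free z.2); last first.
  by rewrite !asboolF// => -[].
rewrite [in RHS]asboolT//.
have Phi0 e : (0 <= Phi (z.2 e) (mass z.1 (src e) * r (src e) (tgt e)))%E.
  by rewrite Phi_ge0 ?flow_ge0// mulr_ge0// mass_ge0.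
have [van|Nvan] := pselect (vanishes_off (limit_edges E r) z.2).
  rewrite asboolT// [RHS](bigID (fun e => val e \in limit_edges E r))/=.
  (* Edges outside the limit set carry no flow and have zero limit rate, and [Phi 0 0 = 0]. *)
  rewrite [X in (_ + X)%E]big1 ?adde0// => e eE0.
  by rewrite van// E0N// mulr0 /Phi eqxx.
rewrite asboolF; last by move=> [].
move: Nvan; rewrite /vanishes_off -existsNE => -[e].
move=> /not_implyP[eE0 /eqP ze]; apply/esym/eqP; rewrite -leye_eq.
(* The edge [e] has nonzero flow and zero limit rate, so its term is [+oo]; the other terms are
   nonnegative and cannot cancel it. *)
rewrite (bigD1 e)//= E0N// mulr0 {1}/Phi (negbTE ze) eqxx addye//.
by rewrite gt_eqF// (lt_le_trans (ltNyr 0))// sume_ge0.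
Qed.

(** * Gamma-convergence of rate functionals under convergence of the rates *)

Section rates_cvg.
Context (r_ : nat -> V -> V -> R) (r : V -> V -> R).
Hypothesis r_ge0 : forall n (e : edge E), 0 <= r_ n (src e) (tgt e).
Hypothesis cvg_r : forall e : edge E,
  r_ n (src e) (tgt e) @[n --> \oo] --> r (src e) (tgt e).

Lemma rate_functional_liminf (z_ : nat -> prob R x0 * flow R E) z :
  z_ @ \oo --> z ->
  (rate_functional r z <= limn_einf (fun n => rate_functional (r_ n) (z_ n)))%E.
Proof.
move=> cz; have [div_free|Ndiv] := pselect (divergence_free z.2); last first.
  have [einfy _] := cvg_limn_einf_sup (@cvg_cst _ (+oo%E : \bar R) _ \oo _).
  rewrite {1}/rate_functional asboolF// -einfy; apply: le_limn_einf.
  have := divergence_free_closed cz Ndiv; apply: filterS => n Ndiv_n.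
  by rewrite /rate_functional asboolF.
rewrite {1}/rate_functional asboolT//.
have p_ge0 n (e : edge E) : 0 <= mass (z_ n).1 (src e) * r_ n (src e) (tgt e).
  by rewrite mulr_ge0 ?mass_ge0.
(* Some [z_ n] may fail to be divergence-free, but the functional is then [+oo] and still dominates
   the sum. *)
have le_rate : (limn_einf (fun n => \sum_(e : edge E) Phi ((z_ n).2 e)
    (mass (z_ n).1 (src e) * r_ n (src e) (tgt e))) <=
  limn_einf (fun n => rate_functional (r_ n) (z_ n)))%E.
  apply: le_limn_einf; apply: nearW => n.
  by rewrite /rate_functional; case: ifP => // _; rewrite leey.
apply: le_trans le_rate; apply: le_trans (limn_einf_nnesum _).
  apply: lee_sum => e _; apply: Phi_lsc => // [n||].
  - exact: flow_ge0.
  - exact: cvg_flow.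
  - by apply: cvgM => //; exact: cvg_mass.
by move=> e n; rewrite Phi_ge0 ?flow_ge0.
Qed.

Lemma rate_functional_limsup_cst z :
  (limn_esup (fun n => rate_functional (r_ n) z) <= rate_functional r z)%E.
Proof.
(* The flow is the same on both sides, so a single case distinction settles the divergence condition
   for all [n] and for the limit. *)
rewrite /rate_functional; case: ifP => _; last by rewrite leey.
have p_ge0 n (e : edge E) : 0 <= mass z.1 (src e) * r_ n (src e) (tgt e).
  by rewrite mulr_ge0 ?mass_ge0.
have cvg_rate : (\sum_(e : edge E) Phi (z.2 e)
      (mass z.1 (src e) * r_ n (src e) (tgt e)))%E @[n --> \oo] -->
    (\sum_(e : edge E) Phi (z.2 e) (mass z.1 (src e) * r (src e) (tgt e)))%E.
  apply: cvg_nnesum => e _.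
    by apply: nearW => n; rewrite Phi_ge0 ?flow_ge0.
  by apply: Phi_cvgr => //; [exact: flow_ge0|exact: cvgMr].
by have [_ ->] := cvg_limn_einf_sup cvg_rate.
Qed.

Lemma rate_functional_gamma_cvg :
  gamma_cvg (fun n => @rate_functional R V x0 E (r_ n)) (rate_functional r).
Proof.
move=> z; split=> [z_|]; first exact: rate_functional_liminf.
exists (fun=> z); [exact: cvg_cst|exact: rate_functional_limsup_cst].
Qed.

End rates_cvg.

End functionals.

Theorem proposition2p1 (R : realType) (V : finType) (x0 : V)
    (r : nat -> V -> V -> R) (E : {set V * V}) (r0 : V -> V -> R)
    (r_rates : forall n, jump_rates (r n))
    (r_irr : forall n, irreducible (r n))
    (r_edges : forall n, jump_edges (r n) = E)
    (r_cvg : forall x y, (x, y) \in E -> r n x y @[n --> \oo] --> r0 x y)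
    (E0_neq0 : limit_edges E r0 != finset.set0) :
  gamma_cvg (fun n => @rate_functional R V x0 E (r n)) (@limit_functional R V x0 E r0).
Proof.
have r_ge0 n (e : edge E) : 0 <= r n (src e) (tgt e).
  have : val e \in jump_edges (r n) by rewrite r_edges (valP e).
  by rewrite inE => /andP[_ /ltW].
have cvg_r (e : edge E) :
    r n (src e) (tgt e) @[n --> \oo] --> r0 (src e) (tgt e).
  by apply: r_cvg; rewrite /src /tgt -surjective_pairing (valP e).
rewrite (_ : @limit_functional R V x0 E r0 = rate_functional r0).
  exact: rate_functional_gamma_cvg.
(* The limit rates are nonnegative on [E], as limits of nonnegative rates. *)
apply/funext => z; apply: limit_functionalE => e.
by apply: limn_ge0 (cvg_r e).
Qed.
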